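(* For any two cardinals $\kappa$ and $\lambda$ with $\omega<\operatorname{cf}(\lambda)=\lambda\le\kappa$ there is a $\mathcal C(\kappa)$-space that is not $\lambda$-extraresolvable (and hence not $\lambda$-resolvable) and still it is hereditarily $\mu$-resolvable for all $\mu<\lambda$.
   Context: For a space $X$, $\Delta(X)$ is the minimum cardinality of a nonempty open subset of $X$, and $\operatorname{nwd}(X)$ is the minimum cardinality of a somewhere dense (i.e. not nowhere dense) subset of $X$. $X$ is NODEC if all nowhere dense subsets of $X$ are closed (hence closed discrete). $D(2)$ is the discrete two-point space. For an infinite cardinal $\kappa$, a $\mathcal C(\kappa)$-space is a dense NODEC subspace $X$ of the Cantor cube $D(2)^{2^\kappa}$ with $|X|=\operatorname{nwd}(X)=\Delta(X)=\kappa$. $X$ is $\mu$-resolvable if it contains $\mu$ many pairwise disjoint dense subsets. $X$ is $\lambda$-extraresolvable if there are $\lambda$ many dense subsets of $X$ such that any two of them have nowhere dense intersection. A space is crowded if it has no isolated points; $X$ is hereditarily $\mu$-resolvable if all (nonempty) crowded subspaces of $X$ are $\mu$-resolvable. *)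

(* Defs.v *)
From mathcomp Require Import all_boot all_order all_algebra.
From mathcomp Require Import all_classical all_reals all_analysis.
From mathcomp Require Import wochoice.

Set Implicit Arguments.
Unset Strict Implicit.
Unset Printing Implicit Defensive.

Local Open Scope classical_set_scope.
Local Open Scope card_scope.

(* A cardinal is represented by a type, taken up to bijection; [#<=] and [#=]
   compare sets, so the cardinal of a type [K] is that of [[set: K]]. *)
Definition card_lt (T U : Type) (A : set T) (B : set U) : Prop :=
  A #<= B /\ ~ (B #<= A).

Definition is_min_card (T : Type) (P : set (set T)) (K : Type) : Prop :=
  (exists2 S, P S & S #= [set: K]) /\ (forall S, P S -> [set: K] #<= S).

(* [r] has the order type of the initial ordinal of cardinality |L|.
   [well_order] implies that [r] is a reflexive total order. *)
Definition initial_well_order (L : Type) (r : rel L) : Prop :=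
  well_order r /\
  forall x : L, card_lt [set y | r y x /\ y <> x] [set: L].

Definition cofinal (L : Type) (r : rel L) (S : set L) : Prop :=
  forall x, exists2 y, S y & r x y.

(* cf(|L|) = |C|; the order [r] is unique up to isomorphism. *)
Definition is_cofinality (L C : Type) : Prop :=
  exists2 r : rel L, initial_well_order r & is_min_card (cofinal r) C.

Section Spaces.
Variable T : topologicalType.

Definition nowhere_dense (S : set T) : Prop := interior (closure S) = set0.

Definition is_Delta (K : Type) : Prop :=
  is_min_card [set U : set T | open U /\ U !=set0] K.

Definition is_nwd (K : Type) : Prop :=
  is_min_card [set S : set T | ~ nowhere_dense S] K.

Definition nodec : Prop := forall S : set T, nowhere_dense S -> closed S.

Definition crowded : Prop := isolated [set: T] = set0.

Definition resolvable (M : Type) : Prop :=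
  exists DD : set (set T),
    [/\ DD #= [set: M],
        (forall D, DD D -> dense D) &
        (forall D E, DD D -> DD E -> D <> E -> D `&` E = set0)].

Definition extraresolvable (M : Type) : Prop :=
  exists DD : set (set T),
    [/\ DD #= [set: M],
        (forall D, DD D -> dense D) &
        (forall D E, DD D -> DD E -> D <> E -> nowhere_dense (D `&` E))].

End Spaces.

(* Subsets are made into spaces through the coercion to [set_type], which
   carries the subspace topology. *)
Definition hereditarily_resolvable (T : topologicalType) (M : Type) : Prop :=
  forall Y : set T, Y !=set0 -> crowded Y -> resolvable Y M.

(* [K -> bool] has cardinality 2^|K|. *)
Definition cantor_cube (K : Type) : topologicalType :=
  {ptws (K -> bool) -> bool}.

Definition is_C_space (K : Type) (X : set (cantor_cube K)) : Prop :=
  [/\ dense X, nodec X, X #= [set: K], is_nwd X K & is_Delta X K].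

(* Main.v *)
Require Import Defs.
From mathcomp Require Import all_boot all_order all_algebra.
From mathcomp Require Import all_classical all_reals all_analysis.
From mathcomp Require Import wochoice.

(** The space is obtained by forcing a prescribed family of dense sets on it,
    as in the work of Juhász, Soukup and Szentmiklósy on D-forced spaces.
    Write kappa = |K| and lambda = |L|, and let [r] order L in type lambda.

    A set S of size kappa carries binary coordinates [chi z], one for each
    z : K -> bool, and partial functions [phi l : S -> option L], one for each
    l : L.  A basic open set is a cylinder, which fixes finitely many
    coordinates; a layer fixes finitely many values [phi l = h l], where h is
    regressive: [h l] lies strictly below l.  A piece is the trace of a layer
    on a cylinder.  One starts from coordinates and partial functions that are
    fully independent, every piece having size kappa ([independent_system]).

    The coordinates are then modified.  Each z codes a pair (E, t) of a subset
    and a point of S, every pair being coded; modifying z makes t the only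
    possible point of E on the side of [chi z] where t lies.  So E becomes
    closed and discrete once all the coordinates that code a pair (E, t) are
    modified.  By Zorn's lemma there is a maximal family of sets E, containing
    all sets of size less than kappa, whose coordinates can all be modified
    while every layer remains dense.  If E is not in that family, then
    modifying its coordinates too would empty some piece; that piece lay in E
    except for finitely many points, which a smaller cylinder avoids.  Hence
    every set either is closed and discrete or contains a piece, where pieces
    are somewhere dense of size kappa ([forced_modification]).  Thus nowhere
    dense sets are closed, and nwd and Delta are kappa.

    Let Y be crowded and mu < lambda.  No nonempty relatively open part of Y
    is discrete, so each contains a piece, and a maximal disjoint family of
    cylinders carrying pieces inside Y covers a dense part of Y.  A layer has
    mu many disjoint dense refinements, obtained by fixing one more value
    [phi l]; as lambda is regular, l can be chosen to have at least mu
    predecessors ([splitting_level]).  Doing so in each cylinder of the family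
    gives mu disjoint dense subsets of Y.

    Given lambda many dense sets, choose a piece inside each.  The finite
    conditions describing pieces satisfy the lambda-chain condition, as for
    the Levy collapse of lambda ([chain_condition]): two of them are
    compatible, and their union describes a piece inside the intersection of
    two of the dense sets, which is therefore somewhere dense. *)

Set Implicit Arguments.
Unset Strict Implicit.
Unset Printing Implicit Defensive.

Local Open Scope classical_set_scope.
Local Open Scope card_scope.

(** * Cardinal arithmetic by Zorn's lemma *)

Lemma inj_card_leT (T U : Type) (B : set U) (f : T -> U) :
  (forall x, B (f x)) -> injective f -> [set: T] #<= B.
Proof.
move=> fB finj; rewrite -(card_le_eql (inj_card_eq (in2W finj))).
by apply: subset_card_le => _ [x _ <-].
Qed.

Lemma card_leT_inj (T U : Type) (B : set U) :
  [set: T] #<= B -> exists2 f : T -> U, (forall x, B (f x)) & injective f.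
Proof.
move=> /card_leP[f]; exists (fun x => set_val (f (to_setT x))).
  by move=> x; exact: set_valP.
by move=> x y /val_inj /(@inj _ _ _ f); rewrite !in_setT => /(_ isT isT) [].
Qed.

Lemma card_le_inj (T U : Type) (A : set T) (B : set U) (u0 : U) : A #<= B ->
  exists2 f : T -> U, (forall x, A x -> B (f x)) &
    forall x y, A x -> A y -> f x = f y -> x = y.
Proof.
rewrite -(card_le_eql (card_setT A)) => /card_leT_inj[g gB ginj].
exists (fun x => if pselect (A x) is left Ax
                 then g (SigSub (mem_set Ax)) else u0) => [x Ax|x y Ax Ay].
  by case: pselect.
by case: pselect => // Ax'; case: pselect => // Ay' /ginj/(congr1 val).
Qed.

(** A form of Zorn's lemma in which the union of a chain has to be examined
    for nonempty chains only, the starting point [A0] bounding the empty one. *)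
Lemma Zorn_above (T : Type) (P : set (set T)) (A0 : set T) :
    P A0 ->
    (forall F, F !=set0 -> F `<=` P -> total_on F subset ->
      P (\bigcup_(A in F) A)) ->
  exists A, [/\ P A, A0 `<=` A & forall B, A `<=` B -> P B -> B = A].
Proof.
move=> PA0 Pchain.
have [|A [/= PA Amax]] := @Zorn_bigcup T [set A | P (A0 `|` A)].
  move=> F FP Ft /=; have [->|/set0P[C FC]] := eqVneq F set0.
    by rewrite bigcup_set0 setU0.
  have -> : A0 `|` \bigcup_(A in F) A =
      \bigcup_(B in [set A0 `|` A | A in F]) B.
    apply/seteqP; split=> [x [A0x|[A FA Ax]]|x [_ [A FA <-] [A0x|Ax]]].
    - by exists (A0 `|` C); [exists C|left].
    - by exists (A0 `|` A); [exists A|right].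
    - by left.
    - by right; exists A.
  apply: Pchain => [|_ [A FA <-]|]; first by exists (A0 `|` C), C.
    exact: FP.
  move=> _ _ [A FA <-] [B FB <-].
  by case: (Ft _ _ FA FB) => AB; [left|right]; exact: setUS.
exists (A0 `|` A); split=> // B AB PB; apply: contrapT => nBA.
apply: (Amax B); last by rewrite /= setUidr // => x A0x; apply: AB; left.
split; first by move=> x Ax; apply: AB; right.
by move=> BA; apply: nBA; apply/seteqP; split=> // x /BA; right.
Qed.

(** A maximal partial injection between two types is total or surjective. *)
Lemma card_le_total (T U : Type) :
  [set: T] #<= [set: U] \/ [set: U] #<= [set: T].
Proof.
pose pinj (G : set (T * U)) := forall x y x' y', G (x, y) -> G (x', y') ->
  x = x' <-> y = y'.
have [|F _ FP Ft x y x' y' [G FG Gx] [G' FG' Gx']|G [Gi _ Gmax]] :=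
    @Zorn_above _ pinj set0; first by [].
  case: (Ft _ _ FG FG') => s; first by apply: (FP _ FG') => //; exact: s.
  by apply: (FP _ FG) => //; exact: s.
have [Gl|/existsNP[x nx]] := pselect (forall x, exists y, G (x, y)).
  have [f fP] := choice Gl; left; apply: (@inj_card_leT _ _ _ f) => // x x' e.
  by apply/(Gi _ _ _ _ (fP x) (fP x')).
have [Gr|/existsNP[y ny]] := pselect (forall y, exists x, G (x, y)).
  have [f fP] := choice Gr; right; apply: (@inj_card_leT _ _ _ f) => // y y' e.
  by apply/(Gi _ _ _ _ (fP y) (fP y')).
exfalso; apply: (nx); exists y.
rewrite -(Gmax (G `|` [set (x, y)])); [by right|by move=> ?; left|].
move=> u v u' v' [Guv|[-> ->]] [Guv'|[-> ->]] //; first exact: Gi Guv Guv'.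
- by split=> e; [case: nx; exists v; rewrite -e|case: ny; exists u; rewrite -e].
- by split=> e; [case: nx; exists v'; rewrite e|case: ny; exists u'; rewrite e].
Qed.

Section Pairing.
Variable K : choiceType.

Definition partial_pairing (A : set K) (p : K -> K -> K) : Prop :=
  (forall x y, A x -> A y -> A (p x y)) /\
  (forall x y x' y', A x -> A y -> A x' -> A y' ->
    p x y = p x' y' -> x = x' /\ y = y').

(* Zorn's lemma is applied to graphs of partial pairings, since these are
   ordered by inclusion. *)
Let dom (G : set (K * K * K)) : set K := [set x | exists z, G (x, x, z)].

Let pairing_graph (G : set (K * K * K)) : Prop :=
  [/\ forall x y z, G (x, y, z) -> [/\ dom G x, dom G y & dom G z],
      forall x y, dom G x -> dom G y -> exists z, G (x, y, z),
      forall x y z z', G (x, y, z) -> G (x, y, z') -> z = z' &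
      forall x y x' y' z, G (x, y, z) -> G (x', y', z) -> x = x' /\ y = y'].

Let graph (A : set K) p : set (K * K * K) :=
  [set t | A t.1.1 /\ A t.1.2 /\ t.2 = p t.1.1 t.1.2].

Let graph_dom A p : dom (graph A p) = A.
Proof.
apply/seteqP; split=> [x [z [/= Ax _]]//|x Ax].
by exists (p x x).
Qed.

Let pairing_graphP A p : partial_pairing A p -> pairing_graph (graph A p).
Proof.
move=> [pA pinj]; rewrite /pairing_graph graph_dom; split.
- by move=> x y z [/= Ax [Ay ->]]; split=> //; exact: pA.
- by move=> x y Ax Ay; exists (p x y).
- by move=> x y z z' [/= _ [_ ->]] [/= _ [_ ->]].
- by move=> x y x' y' z [/= Ax [Ay ->]] [/= Ax' [Ay' e]]; exact: pinj e.
Qed.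

Let pairing_of G : pairing_graph G ->
  exists2 p, partial_pairing (dom G) p & graph (dom G) p = G.
Proof.
move=> [Gd Gt Gf Gi].
have /choice[p pP] : forall t : K * K, exists z,
    dom G t.1 -> dom G t.2 -> G (t.1, t.2, z).
  move=> [x y] /=; have [[Ax Ay]|nA] := pselect (dom G x /\ dom G y).
    by have [z Gz] := Gt _ _ Ax Ay; exists z.
  by exists x => Ax Ay; case: nA.
exists (fun x y => p (x, y)).
  split=> [x y Ax Ay|x y x' y' Ax Ay Ax' Ay' e].
    by have /= /(_ Ax Ay) /Gd[] := pP (x, y).
  have /= /(_ Ax Ay) := pP (x, y); rewrite e => G1.
  by have /= /(_ Ax' Ay') G2 := pP (x', y'); exact: Gi G1 G2.
apply/seteqP; split=> [[[x y] z] [/= Ax [Ay ->]]|[[x y] z] Gz].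
  exact: (pP (x, y)).
have [Ax Ay _] := Gd _ _ _ Gz; split=> //; split=> //=.
exact: Gf Gz (pP (x, y) Ax Ay).
Qed.

Let chain_graph (F : set (set (K * K * K))) :
  (forall G, F G -> pairing_graph G) -> total_on F subset ->
  pairing_graph (\bigcup_(G in F) G).
Proof.
move=> FP Ft.
have domS G : F G -> dom G `<=` dom (\bigcup_(G in F) G).
  by move=> FG x [z Gz]; exists z, G.
have join G G' : F G -> F G' -> exists2 H, F H & G `<=` H /\ G' `<=` H.
  move=> FG FG'; case: (Ft _ _ FG FG') => s; last by exists G => //; split.
  by exists G' => //; split.
split.
- move=> x y z [G FG Gxyz]; have [Gd _ _ _] := FP _ FG.
  by have [dx dy dz] := Gd _ _ _ Gxyz; split; apply: (domS G).
- move=> x y [z [G FG Gx]] [z' [G' FG' Gy]].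
  have [H FH [GH G'H]] := join _ _ FG FG'; have [_ Ht _ _] := FP _ FH.
  have [w Hw] : exists w, H (x, y, w).
    by apply: Ht; [exists z; exact: GH|exists z'; exact: G'H].
  by exists w, H.
- move=> x y z z' [G FG Gx] [G' FG' Gy].
  have [H FH [GH G'H]] := join _ _ FG FG'; have [_ _ Hf _] := FP _ FH.
  exact: Hf (GH _ Gx) (G'H _ Gy).
- move=> x y x' y' z [G FG Gx] [G' FG' Gy].
  have [H FH [GH G'H]] := join _ _ FG FG'; have [_ _ _ Hi] := FP _ FH.
  exact: Hi (GH _ Gx) (G'H _ Gy).
Qed.

Let countable_pairing : [set: nat] #<= [set: K] ->
  exists A p, [/\ partial_pairing A p, [set: nat] #<= A & A !=set0].
Proof.
move=> /card_leT_inj[f _ finj].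
pose g x := xget 0 [set n | f n = x].
have gK n : g (f n) = n.
  by apply: finj; apply: (xgetPex 0 (P := [set n' | f n' = f n])); exists n.
exists (range f), (fun x y => f (pickle (g x, g y))); split.
- split=> [x y [m _ <-] [n _ <-]|_ _ _ _ [m _ <-] [n _ <-] [m' _ <-] [n' _ <-]].
    by rewrite !gK; exists (pickle (m, n)).
  by rewrite !gK => /finj /(pcan_inj pickleK)[-> ->].
- by apply: inj_card_leT finj => n; exists n.
- by exists (f 0), 0.
Qed.

(** Take a maximal pairing [p] of an infinite subset A of K.  If the complement
    of A embeds in A, then so does K, and [p] pairs K.  Otherwise the
    complement contains a copy of A, in which there is room for the pairs of
    points of the union that do not lie in A: this would extend [p]. *)
Lemma infinite_pairing : [set: nat] #<= [set: K] ->
  exists p : K -> K -> K,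
    forall x y x' y', p x y = p x' y' -> x = x' /\ y = y'.
Proof.
move=> /countable_pairing[A0 [p0 [p0P natA0 [k0 A0k0]]]].
have [|F F0 FP Ft|G [PG GA0 Gmax]] :=
  @Zorn_above _ pairing_graph (graph A0 p0).
- exact: pairing_graphP.
- exact: chain_graph.
have [p pP pG] := pairing_of PG; set A := dom G in pP pG.
have {GA0} A0A : A0 `<=` A.
  by rewrite -(graph_dom A0 p0) -(graph_dom A p) pG => x [z /GA0]; exists z.
have [pA pinj] := pP.
have /(card_le_inj k0)[t tA tinj] : [set: nat] #<= A.
  exact: card_le_trans (subset_card_le A0A).
have {}tA n : A (t n) by exact: tA.
have {}tinj m n : t m = t n -> m = n by exact: tinj.
have [/(card_le_inj k0)[j jA jinj]|] : ~` A #<= A \/ A #<= ~` A.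
  rewrite -(card_le_eql (card_setT A)) -(card_le_eqr (card_setT A)).
  rewrite -(card_le_eql (card_setT (~` A))) -(card_le_eqr (card_setT (~` A))).
  exact: card_le_total.
  pose h x := if pselect (A x) then p (t 0) x else p (t 1) (j x).
  have hA x : A (h x).
    by rewrite /h; case: pselect => Ax; apply: pA => //; exact: jA.
  have hinj x y : h x = h y -> x = y.
    rewrite /h; case: pselect => Ax; case: pselect => Ay /pinj.
    - by case.
    - by case=> //; [exact: jA|move/tinj].
    - by case=> //; [exact: jA|move/tinj].
    - by case=> [||||_ /jinj]; by [exact: jA|auto].
  exists (fun x y => p (h x) (h y)) => x y x' y' /pinj[] //.
  by move=> /hinj -> /hinj ->.
move=> /(card_le_inj k0)[i iA iinj]; exfalso.
pose B := A `|` i @` A.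
have iNA x : A x -> ~ A (i x) by exact: iA.
pose j y := if pselect (A y) then y else xget k0 [set x | A x /\ i x = y].
have jA y : B y -> A (j y).
  rewrite /j; case: pselect => // nAy [//|[x Ax xy]].
  by case: (xgetPex k0 (P := [set x | A x /\ i x = y])); first by exists x.
have jE y : B y -> ~ A y -> i (j y) = y.
  rewrite /j; case: pselect => // nAy [//|[x Ax xy]] _.
  by case: (xgetPex k0 (P := [set x | A x /\ i x = y])); first by exists x.
have jA' y : A y -> j y = y by rewrite /j; case: pselect.
(* The tag, one of four points of A, records on which side x and y lie, which
   [j x] and [j y] forget. *)
pose tag (b c : bool) := t (b + c.*2).
have tagI b c b' c' : tag b c = tag b' c' -> b = b' /\ c = c'.
  by move=> /tinj; case: b b' c c' => [] [] [] [] //.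
pose q x y := if pselect (A x /\ A y) then p x y else
  i (p (tag `[< A x >] `[< A y >]) (p (j x) (j y))).
have pp u v : B u -> B v -> A (p (tag `[< A u >] `[< A v >]) (p (j u) (j v))).
  by move=> Bu Bv; apply: (pA); [exact: tA|apply: pA; exact: jA].
have qP : partial_pairing B q.
  split=> [x y Bx By|x y x' y' Bx By Bx' By'].
    rewrite /q; case: pselect => [[Ax Ay]|nA]; first by left; exact: pA.
    right; exists (p (tag `[< A x >] `[< A y >]) (p (j x) (j y))) => //.
    exact: pp.
  have jinj u v : B u -> B v -> `[< A u >] = `[< A v >] -> j u = j v -> u = v.
    move=> Bu Bv; case: asboolP => Au; case: asboolP => Av // _.
      by rewrite !jA'.
    by move=> e; rewrite -(jE u) // -(jE v) // e.
  rewrite /q; case: pselect => [[Ax Ay]|nA]; case: pselect => [[Ax' Ay']|nA'].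
  - exact: pinj.
  - by move=> /= e; case: (iNA _ (pp _ _ Bx' By')); rewrite -e; exact: pA.
  - by move=> /= e; case: (iNA _ (pp _ _ Bx By)); rewrite e; exact: pA.
  - move=> /= /iinj-/(_ (pp _ _ Bx By) (pp _ _ Bx' By')) /pinj[].
    1,3: exact: tA.
    1,2: by apply: pA; exact: jA.
    move=> e /pinj[]; try exact: jA; move=> e1 e2.
    by have [ex ey] := tagI _ _ _ _ e; split; exact: jinj.
have /Gmax : G `<=` graph B q.
  rewrite -pG => -[[x y] z] [/= Ax [Ay ->]]; split; first by left.
  by split; [left|rewrite /q; case: pselect => // -[]].
move=> /(_ (pairing_graphP qP)) /(congr1 dom); rewrite graph_dom -/A => BA.
apply: (iNA (t 0)) => //; rewrite -BA; right; by exists (t 0).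
Qed.

End Pairing.

Section InfiniteArithmetic.
Variable K : choiceType.
Hypothesis K_infinite : [set: nat] #<= [set: K].

Lemma card_le_prod (T U : Type) :
  [set: T] #<= [set: K] -> [set: U] #<= [set: K] -> [set: T * U] #<= [set: K].
Proof.
move=> /card_leT_inj[f _ finj] /card_leT_inj[g _ ginj].
have [p pinj] := infinite_pairing K_infinite.
apply: (@inj_card_leT _ _ _ (fun z => p (f z.1) (g z.2))) => // -[x y] [x' y'].
by move=> /pinj[/finj /= -> /ginj /= ->].
Qed.

(** A sequence is coded by its length and the iterated pairing of its terms. *)
Lemma card_le_seq (T : Type) :
  [set: T] #<= [set: K] -> [set: seq T] #<= [set: K].
Proof.
move=> /card_leT_inj[f _ finj]; have [p pinj] := infinite_pairing K_infinite.
have [c _ cinj] := card_leT_inj K_infinite.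
pose code s := p (c (size s)) (foldr (p \o f) (c 0) s).
apply: (@inj_card_leT _ _ _ code) => // s s' /pinj[/cinj].
elim: s s' => [|x s IHs] [|x' s'] //= [es].
by move=> /pinj[/finj -> /(IHs _ es) ->].
Qed.

(** K is a union of |K| columns, each of size |K|: either some column lies in
    A, or B meets all of them. *)
Lemma card_le_setU (T : Type) (A B : set T) :
  [set: K] #<= A `|` B -> [set: K] #<= A \/ [set: K] #<= B.
Proof.
move=> /card_leT_inj[f fAB finj]; have [p pinj] := infinite_pairing K_infinite.
have [[k kA]|/forallNP nA] := pselect (exists k, forall x, A (f (p k x))).
  by left; apply: inj_card_leT kA _ => x y /finj/pinj[].
have /choice[g gB] : forall k, exists x, B (f (p k x)).
  move=> k; have /existsNP[x nAx] := nA k.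
  by exists x; case: (fAB (p k x)).
by right; apply: inj_card_leT gB _ => k k' /finj/pinj[].
Qed.

Lemma card_le_bigcup_seq (T : Type) (I : choiceType) (s : seq I)
    (E : I -> set T) :
  [set: K] #<= [set x | exists2 i, i \in s & E i x] ->
  exists2 i, i \in s & [set: K] #<= E i.
Proof.
elim: s => [|i s IHs].
  move=> /card_leT_inj[f fP _]; have [c _ _] := card_leT_inj K_infinite.
  by have [] := fP (c 0).
have -> : [set x | exists2 j, j \in i :: s & E j x] =
    E i `|` [set x | exists2 j, j \in s & E j x].
  apply/seteqP; split=> [x [j]|x [Ex|[j js Ejx]]].
  - rewrite inE => /orP[/eqP -> Ex|js Ejx]; [by left|by right; exists j].
  - by exists i; rewrite ?mem_head.
  - by exists j; rewrite // inE js orbT.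
move=> /card_le_setU[Ei|/IHs[j js Ej]]; first by exists i; rewrite ?mem_head.
by exists j; rewrite // inE js orbT.
Qed.

Lemma not_card_le_set1 (T : Type) (x : T) : ~ ([set: K] #<= [set x]).
Proof.
move=> /(card_le_trans K_infinite)/card_leT_inj[f fx finj].
by have /finj : f 0 = f 1 by rewrite !fx.
Qed.

Lemma infinite_pred : [set: nat] #<= [set: K -> bool].
Proof.
apply: (card_le_trans K_infinite).
apply: (@inj_card_leT _ _ _ (fun k k' => k == k')) => // k k' /(congr1 (@^~ k)).
by rewrite eqxx => /esym/eqP.
Qed.

End InfiniteArithmetic.

(** * An independent system of coordinates and partial functions *)

(** Total functions [b] and [h], of which only the values on the lists [F] and
    [G] matter, make every such condition consistent. *)
Definition cyl (Z : choiceType) (S : Type) (chi : Z -> S -> bool)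
    (F : seq Z) (b : Z -> bool) : set S :=
  [set s | {in F, forall z, chi z s = b z}].

Definition layer (L : choiceType) (S : Type) (phi : L -> S -> option L)
    (G : seq L) (h : L -> L) : set S :=
  [set s | {in G, forall l, phi l s = Some (h l)}].

Section Base.
Variables (K L : choiceType).
Hypothesis K_infinite : [set: nat] #<= [set: K].
Hypothesis L_le_K : [set: L] #<= [set: K].

Lemma separating_seq (F : seq (K -> bool)) :
  exists Q : seq K, {in F &, injective (fun z => map z Q)}.
Proof.
have [c _ _] := card_leT_inj K_infinite.
pose d (z z' : K -> bool) := xget (c 0) [set k | z k <> z' k].
exists [seq d z z' | z <- F, z' <- F] => z z' zF z'F e.
have dF : d z z' \in [seq d z z' | z <- F, z' <- F].
  by apply/allpairsP; exists (z, z').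
have := congr1 (fun s => nth true s
  (index (d z z') [seq d z z' | z <- F, z' <- F])) e.
rewrite !(nth_map (c 0)) ?index_mem // nth_index // => ed.
apply: contrapT => nz.
have [k zk] : exists k, z k <> z' k.
  apply: contrapT => /forallNP nk; apply: nz; apply/funext => k.
  by apply: contrapT; exact: nk.
by apply: (xgetPex (c 0) (P := [set k | z k <> z' k])) ed; exists k.
Qed.

Fixpoint assoc (t : seq (L * L)) (l : L) : option L :=
  if t is (l', v) :: t' then if l' == l then Some v else assoc t' l else None.

Lemma assoc_map (h : L -> L) (G : seq L) (l : L) :
  l \in G -> assoc [seq (l', h l') | l' <- G] l = Some (h l).
Proof.
elim: G => //= l' G IHG; rewrite inE eq_sym; case: eqP => [-> //|_] /=.
exact: IHG.
Qed.

(** As in the theorem of Fichtenholz, Kantorovich and Hausdorff, a point carries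
    finite data [Q : seq K] and [H : seq (seq bool)], and [chi z] asks whether
    H contains the restriction of z to Q; as finitely many distinct z are
    separated by some Q, their values can be prescribed.  The functions [phi]
    are read off a finite association list.  The component in K is free, which
    makes every piece as large as K. *)
Lemma independent_system : exists S : choiceType,
  exists chi : (K -> bool) -> S -> bool, exists phi : L -> S -> option L,
  [set: S] #= [set: K] /\
  forall F b G h, [set: K] #<= cyl chi F b `&` layer phi G h.
Proof.
pose S : choiceType := (K * seq (L * L) * (seq K * seq (seq bool)))%type.
pose chi (z : K -> bool) (s : S) := map z s.2.1 \in s.2.2.
exists S, chi, (fun l s => assoc s.1.2 l); split=> [|F b G h].
  rewrite card_eq_le; apply/andP; split; last first.
    apply: (@inj_card_leT _ _ _ (fun k => (k, [::], ([::], [::])))) => //.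
    by move=> x y [].
  apply: card_le_prod => //; apply: card_le_prod => //.
  - by apply: card_le_seq => //; exact: card_le_prod.
  - exact: card_le_seq.
  - exact: card_le_trans (countableP _) K_infinite.
have [Q Qinj] := separating_seq F.
pose H := [seq map z Q | z <- F & b z].
apply: (@inj_card_leT _ _ _ (fun k => (k, [seq (l, h l) | l <- G], (Q, H)))).
  move=> k; split=> [z zF|l lG] /=; last exact: assoc_map.
  rewrite /chi /=; apply/mapP/idP => [[z']|bz]; last first.
    by exists z; rewrite ?mem_filter ?bz.
  by rewrite mem_filter => /andP[bz' z'F] /(Qinj _ _ zF z'F) ->.
by move=> x y [].
Qed.

(** Two disjoint copies of K inside K let one z code both a subset and a point
    of S. *)
Lemma decoding (S : choiceType) : [set: S] #<= [set: K] -> S ->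
  exists d : (K -> bool) -> set S * S, forall E s, exists z, d z = (E, s).
Proof.
move=> /card_leT_inj[e _ einj] s0.
have [p pinj] := infinite_pairing K_infinite.
have [c _ cinj] := card_leT_inj K_infinite.
exists (fun z =>
  ([set s | z (p (c 0) (e s))], xget s0 [set s | z (p (c 1) (e s))])) => E s.
exists (fun k =>
  `[< (exists2 t, E t & k = p (c 0) (e t)) \/ k = p (c 1) (e s) >]).
congr pair.
  apply/seteqP; split=> t /= => [/asboolP[[t' Et'] /pinj[_ /einj ->] //|]|Et].
    by move=> /pinj[/cinj].
  by apply/asboolP; left; exists t.
case: xgetP => [t _ /asboolP[[t' _ /pinj[/cinj]] //|/pinj[_ /einj]]|] //.
by move=> /(_ s) []; apply/asboolP; right.
Qed.

End Base.

(** * Modification of the coordinates *)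

Definition regressive (L : choiceType) (r : rel L) (G : seq L) (h : L -> L) :
  Prop := {in G, forall l, r (h l) l /\ h l <> l}.

(** The dichotomy that drives the proof: [discr] collects the sets that the
    cylinders make closed and discrete, and every other set contains a piece. *)
Record forced (K L Z : choiceType) (S : Type) (r : rel L)
    (chi : Z -> S -> bool) (phi : L -> S -> option L)
    (discr : set (set S)) : Prop := {
  forced_dense : forall F b G h, regressive r G h ->
    cyl chi F b `&` layer phi G h !=set0;
  forced_isolate : forall E s, discr E ->
    exists2 z, chi z s & forall t, E t -> t <> s -> chi z t = false;
  forced_piece : forall E, ~ discr E -> exists F b G h,
    regressive r G h /\ cyl chi F b `&` layer phi G h `<=` E;
  forced_small : forall E, discr E \/ [set: K] #<= E }.

Lemma cyl_neq0 (K L Z : choiceType) (S : Type) (r : rel L)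
    (chi : Z -> S -> bool) (phi : L -> S -> option L) discr :
  forced K r chi phi discr -> forall F b, cyl chi F b !=set0.
Proof.
move=> Sforced F b; have nilr : regressive r [::] id by [].
by have [s [sF _]] := forced_dense Sforced F b nilr; exists s.
Qed.

Lemma infinite_notin (T : choiceType) (F : seq T) : [set: nat] #<= [set: T] ->
  exists z, z \notin F.
Proof.
move=> /infiniteP Tinf; apply: contrapT => /forallNP nF; apply: Tinf.
apply: (@sub_finite_set _ _ [set` F]) => // z _ /=.
by apply/negPn/negP; exact: nF.
Qed.

(** One more coordinate, with the value opposite to that of a point, removes
    this point. *)
Lemma cyl_avoid (Z : choiceType) (S : eqType) (chi : Z -> S -> bool)
    (F : seq Z) (b : Z -> bool) (Q : seq S) : [set: nat] #<= [set: Z] ->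
  exists F' b', cyl chi F' b' `<=` cyl chi F b /\
    forall s, cyl chi F' b' s -> s \notin Q.
Proof.
move=> Zinf; elim: Q => [|q Q [F' [b' [sub avoid]]]]; first by
  exists F, b; split.
have [z zF'] := infinite_notin F' Zinf.
exists (z :: F'), (fun w => if w == z then ~~ chi z q else b' w).
have sub' : cyl chi (z :: F') (fun w => if w == z then ~~ chi z q else b' w)
    `<=` cyl chi F' b'.
  move=> s sC w wF'; rewrite sC ?inE ?wF' ?orbT //.
  by case: eqP => // wz; rewrite -wz wF' in zF'.
split=> [s /sub'/sub//|s sC]; rewrite inE negb_or.
rewrite avoid ?andbT; last exact: sub'.
apply/eqP => sq; have := sC z (mem_head _ _).
by rewrite eqxx sq; case: (chi z q).
Qed.

Section Construction.
Variables (K L S : choiceType) (r : rel L).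
Let Z : choiceType := (K -> bool).
Variables (B : Z -> S -> bool) (phi : L -> S -> option L) (d : Z -> set S * S).
Hypothesis K_infinite : [set: nat] #<= [set: K].
Hypothesis indep : forall F b G h, [set: K] #<= cyl B F b `&` layer phi G h.
Hypothesis d_surj : forall E s, exists z, d z = (E, s).

Definition modify (A : set (set S)) (z : Z) (s : S) : bool :=
  if `[< A (d z).1 >] then (s == (d z).2) || (s \notin (d z).1) && B z s
  else B z s.

Let admissible (A : set (set S)) : Prop := forall F b G h, regressive r G h ->
  cyl (modify A) F b `&` layer phi G h !=set0.

Let small : set (set S) := [set E | ~ ([set: K] #<= E)].

Let Zinf : [set: nat] #<= [set: Z] := infinite_pred K_infinite.

Let modifyE A z s : ~ (A (d z).1 /\ (d z).1 s) -> s <> (d z).2 ->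
  modify A z s = B z s.
Proof.
rewrite /modify => nA; case: asboolP => // Az /eqP/negPf -> /=.
by case: (boolP (s \in (d z).1)) => // /set_mem sE; case: nA.
Qed.

(* The points lost from a piece by modifying at small sets lie in finitely many
   small sets, while the piece has size kappa. *)
Let small_admissible : admissible small.
Proof.
move=> F b G h _; apply: contrapT => empty.
have : [set: K] #<= [set s | exists2 z, z \in F &
    (small (d z).1 /\ (d z).1 s \/ s = (d z).2)].
  apply: card_le_trans (indep F b G h) (subset_card_le _) => s [sF sG].
  apply: contrapT => /forall2NP bad; apply: empty; exists s; split=> // z zF.
  have [//|nz] := bad z; rewrite modifyE ?sF //.
    by move=> ?; apply: nz; left.
  by move=> ?; apply: nz; right.
move=> /(card_le_bigcup_seq K_infinite)[z _ le0].
have : [set: K] #<= [set s | small (d z).1 /\ (d z).1 s] `|` [set (d z).2].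
  exact: le0.
move=> /(card_le_setU K_infinite)[le|le1]; last first.
  by case: (not_card_le_set1 K_infinite le1).
have [c cP _] := card_leT_inj le; have [n _ _] := card_leT_inj K_infinite.
have [smallz _] := cP (n 0).
by apply: smallz; apply: card_le_trans le (subset_card_le _) => s [].
Qed.

(* A cylinder involves finitely many coordinates, so that one member of the
   chain already decides which of them are modified. *)
Let chain_admissible (C : set (set (set S))) : C !=set0 -> C `<=` admissible ->
  total_on C subset -> admissible (\bigcup_(A in C) A).
Proof.
move=> [A0 CA0] Cadm Ctot F b G h Gh.
have [A CA AF] : exists2 A, C A &
    forall z A', z \in F -> C A' -> A' (d z).1 -> A (d z).1.
  elim: F => [|z F [A CA AF]]; first by exists A0.
  have [[A' CA' A'z]|nA'] := pselect (exists2 A', C A' & A' (d z).1).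
    have [H CH [AH A'H]] : exists2 H, C H & A `<=` H /\ A' `<=` H.
      by case: (Ctot _ _ CA CA') => s; [exists A'|exists A] => //; split.
    exists H => // w B'; rewrite inE => /orP[/eqP -> _ _|wF CB' B'w].
      exact: A'H.
    by apply: AH; exact: AF B'w.
  exists A => // w B'; rewrite inE => /orP[/eqP -> CB' B'z|]; last exact: AF.
  by case: nA'; exists B'.
have [s [sF sG]] := Cadm A CA F b G h Gh; exists s; split=> // z zF.
rewrite -sF //; congr (if _ then _ else _); apply/asbool_equiv_eq.
by split=> [[A' CA' /(AF _ _ zF CA')]|Az] //; exists A.
Qed.

Lemma forced_modification :
  exists discr, forced K r (modify discr) phi discr.
Proof.
have [A [Aadm Asmall Amax]] := Zorn_above small_admissible chain_admissible.
exists A; split=> //.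
- move=> E s AE; have [z dz] := d_surj E s; exists z.
    by rewrite /modify dz asboolT //= eqxx.
  move=> t Et /eqP/negPf ts; rewrite /modify dz asboolT //= ts.
  by rewrite mem_set.
- move=> E nAE.
  have : ~ admissible (A `|` [set E]).
    move=> adm; have AE := Amax _ (@subsetUl _ A [set E]) adm.
    by apply: nAE; rewrite -AE; right.
  move=> /existsNP[F /existsNP[b /existsNP[G /existsNP[h]]]].
  move=> /not_implyP[Gh empty].
  (* Off E and finitely many points, modifying at E changes nothing on F. *)
  have [F' [b' [sub avoid]]] :=
    cyl_avoid (modify A) F b [seq (d z).2 | z <- F] Zinf.
  exists F', b', G, h; split=> // s [sF' sG]; apply: contrapT => nEs.
  apply: empty; exists s; split=> // z zF; rewrite -(sub _ sF') //.
  have sz : s <> (d z).2.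
    move=> sz; have /negP[] := avoid _ sF'.
    by rewrite sz; apply/mapP; exists z.
  have [Az|nAz] := pselect (A (d z).1).
    by rewrite /modify !asboolT //; left.
  rewrite modifyE //; first by rewrite modifyE //; case.
  by move=> [[|/= ->]].
- by move=> E; have [|/Asmall] := pselect ([set: K] #<= E); [right|left].
Qed.

End Construction.

Lemma forced_system (K L : choiceType) (r : rel L) :
    [set: nat] #<= [set: K] -> [set: L] #<= [set: K] ->
  exists S : choiceType, exists chi : (K -> bool) -> S -> bool,
    exists phi discr, [set: S] #= [set: K] /\ forced K r chi phi discr.
Proof.
move=> Kinf LK; have [S [B [phi [SK indep]]]] := independent_system Kinf LK.
move: (SK); rewrite card_eq_le => /andP[leSK /card_leT_inj[f _ _]].
have [c _ _] := card_leT_inj Kinf.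
have [d d_surj] := decoding Kinf leSK (f (c 0)).
have [discr fd] := forced_modification r Kinf indep d_surj.
by exists S, (modify B d discr), phi, discr.
Qed.

(** * Topology of a space with forced layers *)

Section ForcedSpace.
Variables (T : topologicalType) (K L Z : choiceType) (r : rel L).
Variables (chi : Z -> T -> bool) (phi : L -> T -> option L).
Variable (discr : set (set T)).
Hypothesis Tforced : forced K r chi phi discr.
Hypothesis Z_infinite : [set: nat] #<= [set: Z].
Hypothesis TE : forall U : set T,
  open U <-> forall t, U t -> exists F, cyl chi F (chi^~ t) `<=` U.

Lemma cyl_open F b : open (cyl chi F b).
Proof.
by apply/TE => t tF; exists F => s sF z zF; rewrite sF // tF.
Qed.

Lemma layer_dense G h : regressive r G h -> dense (layer phi G h).
Proof.
move=> Gh O [t Ot] /TE/(_ t Ot)[F FO].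
have [s [sF sG]] := forced_dense Tforced F (chi^~ t) Gh.
by exists s; split=> //; exact: FO.
Qed.

(** A point of the piece would be isolated in the piece, but a smaller cylinder
    avoids this point and still meets the layer. *)
Lemma piece_not_discr E F b G h : regressive r G h ->
  cyl chi F b `&` layer phi G h `<=` E -> ~ discr E.
Proof.
move=> Gh sub dE; have [t [tF tG]] := forced_dense Tforced F b Gh.
have [z zt zE] := forced_isolate Tforced t dE.
have [F' [b' [sub' avoid]]] :=
  cyl_avoid chi (z :: F) (chi^~ t) [:: t] Z_infinite.
have [s [sF' sG]] := forced_dense Tforced F' b' Gh.
have sF := sub' _ sF'.
have Es : E s.
  by apply: sub; split=> // w wF; rewrite sF ?tF // inE wF orbT.
have st : s <> t by move=> st; move: (avoid _ sF'); rewrite st mem_head.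
by move: (sF z (mem_head _ _)); rewrite zE // zt.
Qed.

Lemma piece_not_nowhere_dense E F b G h : regressive r G h ->
  cyl chi F b `&` layer phi G h `<=` E -> ~ nowhere_dense E.
Proof.
move=> Gh sub Enwd; have [t tF] := cyl_neq0 Tforced F b.
suff : (closure E)^° t by rewrite Enwd.
have nF : nbhs t (cyl chi F b).
  by apply: open_nbhs_nbhs; split=> //; exact: cyl_open.
rewrite /interior; apply: filterS nF => s sF B.
rewrite nbhsE => -[U [oU Us] UB].
have [|u [[Uu uF] uG]] := layer_dense Gh _ (openI oU (cyl_open F b)).
  by exists s.
by exists u; split; [exact: sub|exact: UB].
Qed.

Lemma discr_closed E : discr E -> closed E.
Proof.
move=> dE; rewrite -[E]setCK; apply: open_closedC; apply/TE => t nEt.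
have [z zt zE] := forced_isolate Tforced t dE.
exists [:: z] => s sz Es; have : chi z s = chi z t by exact: sz (mem_head _ _).
by rewrite zE ?zt // => st; apply: nEt; rewrite -st.
Qed.

Lemma open_not_discr U : open U -> U !=set0 -> ~ discr U.
Proof.
move=> /TE oU [t /oU[F FU]].
apply: (@piece_not_discr _ F (chi^~ t) [::] id) => //.
by move=> s [/FU].
Qed.

(** Each side of the dichotomy is thereby identified topologically, which yields
    the NODEC property and the values of nwd and Delta. *)
Lemma discrE E : discr E <-> nowhere_dense E.
Proof.
split=> [dE|]; last first.
  move=> Enwd; apply: contrapT => /(forced_piece Tforced).
  move=> [F [b [G [h [Gh sub]]]]].
  exact: piece_not_nowhere_dense Gh sub Enwd.
apply: contrapT => /eqP/set0P[t tE].
rewrite /nowhere_dense -(closure_id E).1 in tE; last exact: discr_closed.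
have /TE/(_ t tE)[F FE] : open E^° by exact: open_interior.
apply: (@piece_not_discr E F (chi^~ t) [::] id) dE => //.
by move=> s [/FE/interior_subset].
Qed.

Lemma forced_nodec : nodec T.
Proof. by move=> E /discrE/discr_closed. Qed.

Hypothesis TK : [set: T] #= [set: K].

Lemma setT_not_nowhere_dense : ~ nowhere_dense [set: T].
Proof. exact: (@piece_not_nowhere_dense _ [::] xpredT [::] id). Qed.

Lemma forced_nwd : is_nwd T K.
Proof.
split; first by exists [set: T] => //; exact: setT_not_nowhere_dense.
by move=> E /discrE; case: (forced_small Tforced E).
Qed.

Lemma forced_Delta : is_Delta T K.
Proof.
split.
  exists [set: T] => //; split; first exact: openT.
  by have [t _] := cyl_neq0 Tforced [::] xpredT; exists t.
move=> U [oU U0].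
by case: (forced_small Tforced U) => // /(open_not_discr oU U0).
Qed.

(** A relatively open part of Y that belongs to [discr] would have isolated
    points, and these would be isolated in Y. *)
Lemma crowded_piece (Y V : set T) : crowded Y -> open V -> V `&` Y !=set0 ->
  exists F b G h,
    regressive r G h /\ cyl chi F b `&` layer phi G h `<=` V `&` Y.
Proof.
move=> Ycr oV [t [Vt Yt]]; apply: (forced_piece Tforced) => dVY.
have [z zt zE] := forced_isolate Tforced t dVY.
pose y : Y := SigSub (mem_set Yt).
suff : isolated [set: Y] y by rewrite Ycr.
split; first by rewrite in_setT.
pose W : set T := V `&` cyl chi [:: z] xpredT.
exists (val @^-1` W).
  apply: open_nbhs_nbhs; split.
    by exists W => //; apply: openI => //; exact: cyl_open.
  by split=> // w; rewrite inE => /eqP ->.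
apply/seteqP; split=> [x [[Vx xz] _]|_ ->] /=; last first.
  by split=> //; split=> // w; rewrite inE => /eqP ->.
apply: val_inj => /=; apply: contrapT => xt.
have := xz z (mem_head _ _); rewrite zE //; split=> //.
exact: set_valP.
Qed.

(** The m-th dense set is obtained by putting, in each cylinder of a maximal
    disjoint family of cylinders with pieces inside Y, the refined layer in
    which [phi] takes its m-th admissible value at a new level. *)
Lemma forced_hereditarily_resolvable (M : Type) :
  (forall G : seq L, exists2 l, l \notin G &
    exists2 i : M -> L, injective i & forall m, r (i m) l /\ i m <> l) ->
  hereditarily_resolvable T M.
Proof.
move=> split_layer Y [y0 Yy0] Ycr.
pose piece : Type := (seq Z * (Z -> bool) * (seq L * (L -> L)))%type.
pose U (c : piece) : set T := cyl chi c.1.1 c.1.2.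
pose pieces := [set c : piece |
  regressive r c.2.1 c.2.2 /\ U c `&` layer phi c.2.1 c.2.2 `<=` Y].
have [D [Dsub Ddisj Dmax]] := ex_maximal_disjoint_subcollection U pieces.
have /choice[l lP] : forall c : piece, exists l, l \notin c.2.1 /\
    exists2 i : M -> L, injective i & forall m, r (i m) l /\ i m <> l.
  by move=> c; have [l lG il] := split_layer c.2.1; exists l.
have /choice[i iP] : forall c : piece, exists i : M -> L,
    injective i /\ forall m, r (i m) (l c) /\ i m <> l c.
  by move=> c; have [_ [i ii im]] := lP c; exists i.
pose h (c : piece) m k := if k == l c then i c m else c.2.2 k.
pose E m : set T := [set t | exists2 c, D c &
  U c t /\ layer phi (l c :: c.2.1) (h c m) t].
have h_regr c m : D c -> regressive r (l c :: c.2.1) (h c m).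
  move=> /Dsub[cG _] k; rewrite inE /h; case: eqP => [-> _|_ /= kG].
    exact: (iP c).2.
  exact: cG.
have layer_h c m : layer phi (l c :: c.2.1) (h c m) `<=` layer phi c.2.1 c.2.2.
  move=> t tG k kG; rewrite tG ?inE ?kG ?orbT // /h; case: eqP => // kl.
  by have [/negP[]] := lP c; rewrite -kl.
have EY m : E m `<=` Y.
  by move=> t [c Dc [tU /layer_h tG]]; apply: (Dsub _ Dc).2.
have Edisj m m' t : E m t -> E m' t -> m = m'.
  move=> [c Dc [ct tm]] [c' Dc' [c't tm']].
  have ecc' : c = c' by apply: Ddisj => //; exists t.
  rewrite -ecc' in tm'; apply: (iP c).1.
  have := tm _ (mem_head _ _); rewrite (tm' _ (mem_head _ _)) /h eqxx.
  by case.
have Edense m (V : set T) : open V -> V `&` Y !=set0 -> V `&` E m !=set0.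
  move=> oV /(crowded_piece Ycr oV)[F0 [b0 [G0 [h0 [Gh0 sub0]]]]].
  pose c0 := ((F0, b0), (G0, h0)).
  have [c Dc [t [ct c0t]]] : exists2 c, D c & U c `&` U c0 !=set0.
    apply: contrapT => nD.
    have c0U : U c0 !=set0 by exact: cyl_neq0 Tforced _ _.
    apply: (Dmax (D `|` [set c0])).
    - split=> [c Dc|]; first by left.
      move=> /(_ c0 (or_intror erefl)) Dc0; apply: nD; exists c0 => //.
      by rewrite setIid.
    - by move=> c [/Dsub //|->]; split=> // u /sub0[].
    - move=> c c' [Dc|->] [Dc'|->] // cc'; first exact: Ddisj.
        by case: nD; exists c.
      by case: nD; exists c'; rewrite // setIC.
  have [u [[cu c0u] uG0]] := layer_dense Gh0 (ex_intro _ t (conj ct c0t))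
    (openI (cyl_open _ _) (cyl_open _ _)).
  have Vu : V u by exact: (sub0 _ (conj c0u uG0)).1.
  have [v [[Vv cv] vG]] := layer_dense (h_regr c m Dc)
    (ex_intro _ u (conj Vu cu)) (openI oV (cyl_open _ _)).
  by exists v; split=> //; exists c.
pose E' m : set Y := val @^-1` E m.
have E'dense m : dense (E' m).
  move=> O [y Oy] [V oV VO]; have [|t [Vt Et]] := Edense m V oV.
    exists (val y); split; last exact: set_valP.
    by rewrite -VO in Oy.
  exists (SigSub (mem_set (EY _ _ Et))); split=> //.
  by rewrite -VO.
have E'disj m m' y : E' m y -> E' m' y -> m = m' by exact: Edisj.
have E'0 m : E' m !=set0.
  have [|y [_ Ey]] := E'dense m setT _ openT; last by exists y.
  by exists (SigSub (mem_set Yy0)).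
exists (range E'); split.
- apply: inj_card_eq; apply: in2W => m m' e; have [y Ey] := E'0 m.
  by apply: (E'disj _ _ y) => //; rewrite -e.
- by move=> _ [m _ <-]; exact: E'dense.
- move=> _ _ [m _ <-] [m' _ <-] mm'; apply/seteqP; split=> // y [Ey Ey'].
  by case: mm'; rewrite (E'disj _ _ _ Ey Ey').
Qed.

(** Compatible pieces meet in a piece, and the chain condition provides two
    compatible ones among lambda many. *)
Lemma forced_not_extraresolvable :
  (forall (F : L -> seq Z) (b : L -> Z -> bool)
      (G : L -> seq L) (h : L -> L -> L),
    (forall a, regressive r (G a) (h a)) -> exists a a', [/\ a <> a',
      {in F a, forall z, z \in F a' -> b a z = b a' z} &
      {in G a, forall l, l \in G a' -> h a l = h a' l}]) ->
  ~ extraresolvable T L.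
Proof.
move=> cc [DD [DDL DDdense DDnwd]].
move: DDL; rewrite card_eq_le => /andP[_ /card_leT_inj[f fDD finj]].
have /choice[c cP] : forall a,
    exists c : seq Z * (Z -> bool) * (seq L * (L -> L)),
    regressive r c.2.1 c.2.2 /\
    cyl chi c.1.1 c.1.2 `&` layer phi c.2.1 c.2.2 `<=` f a.
  move=> a; have /(forced_piece Tforced) : ~ discr (f a).
    move=> /discrE fnwd; have [t _] := cyl_neq0 Tforced [::] xpredT.
    suff : (closure (f a))^° t by rewrite fnwd.
    apply: (filterS _ filterT) => s _ B; rewrite nbhsE => -[U [oU Us] UB].
    have [|u [Uu fu]] := DDdense _ (fDD a) _ _ oU; first by exists s.
    by exists u; split=> //; exact: UB.
  by move=> [F [b [G [h [Gh sub]]]]]; exists (F, b, (G, h)).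
have [a [a' [aa' bE hE]]] := cc (fun a => (c a).1.1) (fun a => (c a).1.2)
  (fun a => (c a).2.1) (fun a => (c a).2.2) (fun a => (cP a).1).
pose b z := if z \in (c a).1.1 then (c a).1.2 z else (c a').1.2 z.
pose h l := if l \in (c a).2.1 then (c a).2.2 l else (c a').2.2 l.
apply: (@piece_not_nowhere_dense (f a `&` f a') ((c a).1.1 ++ (c a').1.1) b
  ((c a).2.1 ++ (c a').2.1) h); last 1 first.
- by apply: DDnwd => // /finj.
- move=> l; rewrite mem_cat /h; case: ifP => [la _|_ /= la'].
    exact: (cP a).1.
  exact: (cP a').1.
- move=> s [sF sG]; split; apply: (cP _).2; split=> [z zF|l lG].
  + by rewrite sF ?mem_cat ?zF // /b zF.
  + by rewrite sG ?mem_cat ?lG // /h lG.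
  + rewrite sF ?mem_cat ?zF ?orbT // /b; case: ifP => // za; exact: bE.
  + rewrite sG ?mem_cat ?lG ?orbT // /h; case: ifP => // la.
    congr Some; exact: hE.
Qed.

End ForcedSpace.

(** * The chain condition at a regular cardinal *)

Section Regular.
Variables (L : choiceType) (r : rel L).
Hypothesis r_wo : well_order r.
Hypothesis L_large : ~ ([set: L] #<= [set: nat]).
Hypothesis L_regular : forall S, cofinal r S -> [set: L] #<= S.

Let r_chain : chain r predT.
Proof. by apply: wo_chainW => A _; exact: r_wo. Qed.

Let r_total x y : r x y \/ r y x.
Proof. by apply/orP; exact: r_chain. Qed.

Let r_anti x y : r x y -> r y x -> x = y.
Proof.
move=> xy yx; apply: (@wo_chain_antisymmetric _ r predT) => //.
  by move=> A _; exact: r_wo.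
by rewrite xy yx.
Qed.

Let r_refl x : r x x.
Proof. by case: (r_total x x). Qed.

Let r_trans x y z : r x y -> r y z -> r x z.
Proof.
move=> xy yz; have [|m [[mA mlb] _]] := r_wo (A := mem [:: x; y; z]).
  by exists x; exact: mem_head.
have [mx my mz] : [/\ r m x, r m y & r m z].
  by split; apply: mlb; rewrite inE /= !inE eqxx ?orbT.
move: mA; rewrite inE /= !inE => /or3P[]/eqP e; rewrite e in mx my mz => //.
  by rewrite (r_anti xy mx).
by rewrite -(r_anti yz my).
Qed.

(** Regularity enters in this form only: a set of size less than lambda is
    bounded.  This is why the arguments below measure the largeness of subsets
    of L by cofinality. *)
Lemma strict_bound (A : set L) : ~ ([set: L] #<= A) ->
  exists x, forall y, A y -> r y x /\ y <> x.
Proof.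
move=> nA; apply: contrapT => /forallNP nb; apply: nA; apply: L_regular => x.
have /existsNP[y /not_implyP[Ay nyx]] := nb x; exists y => //.
case: (r_total x y) => // yx; apply: contrapT => nxy; apply: nyx; split=> //.
by move=> e; apply: nxy; rewrite e.
Qed.

Lemma strict_bound_seq (s : seq L) :
  exists x, forall y, y \in s -> r y x /\ y <> x.
Proof.
apply: (@strict_bound [set` s]) => sL.
apply: L_large; apply: card_le_trans sL _.
exact: finite_set_countable.
Qed.

(** If the fibres were bounded, then so would be the set of their bounds,
    as there are fewer than lambda of them, and hence A itself. *)
Lemma regular_pigeonhole (I : Type) (W : set I) (A : set L) (c : L -> I) :
  ~ ([set: L] #<= W) -> cofinal r A -> (forall a, A a -> W (c a)) ->
  exists i, cofinal r (A `&` [set a | c a = i]).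
Proof.
move=> nW Acof AW; apply: contrapT => /forallNP nI.
have /choice[b bP] : forall i, exists x, forall a, A a -> c a = i -> ~ r x a.
  move=> i; have /existsNP[x nx] := nI i; exists x => a Aa ca xa.
  by apply: nx; exists a.
have [|x xb] := @strict_bound (b @` W).
  by move=> /card_le_trans/(_ (card_image_le _ _)).
have [a Aa xa] := Acof x.
apply: (bP (c a) a Aa erefl); apply: r_trans xa.
by apply: (xb _ _).1; exists (c a) => //; exact: AW.
Qed.

(** Induction on the size of the domains.  If a coordinate belongs to cofinally
    many domains, it takes one value cofinally often, and can be removed.
    Otherwise each coordinate of a given domain is absent from all far enough
    domains, so that some later domain is disjoint from it. *)
Lemma chain_condition_size (J : eqType) (V : Type) (W : J -> set V) (n : nat)
    (F : L -> seq J) (b : L -> J -> V) (A : set L) :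
  (forall j, ~ ([set: L] #<= W j)) -> cofinal r A ->
  (forall a, A a -> size (F a) <= n) ->
  (forall a j, A a -> j \in F a -> W j (b a j)) ->
  exists a a', [/\ A a, A a', a <> a' &
    {in F a, forall j, j \in F a' -> b a j = b a' j}].
Proof.
move=> Wsmall.
have disjoint_pair (F' : L -> seq J) B : cofinal r B ->
    (forall j, ~ cofinal r (B `&` [set a | j \in F' a])) ->
    exists a a', [/\ B a, B a', a <> a' & {in F' a, forall j, j \notin F' a'}].
  move=> Bcof small; have [x0 _] := strict_bound_seq [::].
  have [a Ba _] := Bcof x0.
  have /choice[x xP] : forall j, exists x,
      forall c, B c -> j \in F' c -> ~ r x c.
    move=> j; have /existsNP[x nx] := small j; exists x => c Bc jc xc.
    by apply: nx; exists c.
  have [y yP] := strict_bound_seq (a :: [seq x j | j <- F' a]).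
  have [a' Ba' ya'] := Bcof y; exists a, a'; split=> //.
    move=> aa'; have [ay []] := yP a (mem_head _ _).
    by apply: r_anti; rewrite // aa'.
  move=> j jF; apply/negP => jF'; apply: (xP j a' Ba' jF').
  by apply: r_trans ya'; apply: (yP _ _).1; rewrite inE map_f ?orbT.
elim: n F A => [|n IHn] F A Acof An AW.
  have [j|a [a' [Aa Aa' aa' _]]] := disjoint_pair F A Acof.
    move=> /(_ (sval (cid (strict_bound_seq [::]))))[a [Aa /= jF] _].
    by have := An a Aa; rewrite leqn0 => /nilP Fa; rewrite Fa in jF.
  exists a, a'; split=> // j; have := An a Aa.
  by rewrite leqn0 => /nilP ->.
have [[j jcof]|/forallNP nj] :=
    pselect (exists j, cofinal r (A `&` [set a | j \in F a])).
  have [v vcof] := regular_pigeonhole (Wsmall j) jcof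
    (fun a Aja => AW a j Aja.1 Aja.2).
  have [||a [a' [[[Aa _] av] [[Aa' _] a'v] aa' baa']]] :=
    IHn (fun a => [seq k <- F a | k != j]) _ vcof.
  - move=> a [[Aa /= jF] _]; rewrite -ltnS; apply: leq_trans (An a Aa).
    rewrite size_filter -(count_predC (pred1 j) (F a)) -addn1 addnC leq_add2r.
    by rewrite -has_count has_pred1.
  - by move=> a k [[Aa _] _]; rewrite mem_filter => /andP[_]; exact: AW.
  exists a, a'; split=> // k kF kF'; have [->|kj] := eqVneq k j.
    by rewrite av a'v.
  by apply: baa'; rewrite mem_filter kj.
have [a [a' [Aa Aa' aa' dis]]] := disjoint_pair F A Acof nj.
by exists a, a'; split=> // j /dis/negPf ->.
Qed.

Lemma chain_condition (J : eqType) (V : Type) (W : J -> set V)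
    (F : L -> seq J) (b : L -> J -> V) :
  (forall j, ~ ([set: L] #<= W j)) ->
  (forall a j, j \in F a -> W j (b a j)) ->
  exists a a', a <> a' /\ {in F a, forall j, j \in F a' -> b a j = b a' j}.
Proof.
move=> Wsmall FW.
have setTcof : cofinal r setT by move=> x; exists x.
have [n /chain_condition_size] := @regular_pigeonhole _ setT setT
  (fun a => size (F a)) L_large setTcof (fun _ _ => I).
move=> /(_ J V W n F b Wsmall)[a [_ <-] //|a j _|a [a' [_ _ aa' baa']]].
  exact: FW.
by exists a, a'.
Qed.

(** A level above a bound of a copy of M and above G. *)
Lemma splitting_level (M : Type) : card_lt [set: M] [set: L] ->
  forall G : seq L, exists2 l, l \notin G &
    exists2 i : M -> L, injective i & forall m, r (i m) l /\ i m <> l.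
Proof.
move=> [/card_leT_inj[i _ iinj] nLM] G.
have [|x xi] := @strict_bound (range i).
  by move=> /card_le_trans/(_ (card_image_le _ _)).
have [l lP] := strict_bound_seq (x :: G); exists l.
  by apply/negP => lG; have [] := lP l; rewrite // inE lG orbT.
have [xl nxl] := lP x (mem_head _ _).
exists i => // m; have [|ix nix] := xi (i m); first by exists m.
split; first exact: r_trans xl.
by move=> il; apply: nxl; apply: r_anti; rewrite // -il.
Qed.

Lemma regressive_chain_condition (Z : choiceType)
    (F : L -> seq Z) (b : L -> Z -> bool) (G : L -> seq L) (h : L -> L -> L) :
  (forall l, ~ ([set: L] #<= [set k | r k l /\ k <> l])) ->
  (forall a, regressive r (G a) (h a)) ->
  exists a a', [/\ a <> a', {in F a, forall z, z \in F a' -> b a z = b a' z} &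
    {in G a, forall l, l \in G a' -> h a l = h a' l}].
Proof.
move=> segment_small Gh.
pose W (j : Z + L) : set (bool + L) :=
  match j with
  | inl _ => range inl
  | inr l => inr @` [set k | r k l /\ k <> l]
  end.
pose FG a : seq (Z + L) := map inl (F a) ++ map inr (G a).
pose v a (j : Z + L) : bool + L :=
  match j with inl z => inl (b a z) | inr l => inr (h a l) end.
have [||a [a' [aa' vE]]] := @chain_condition _ _ W FG v.
- move=> [z|l] LW; last first.
    exact: segment_small (card_le_trans LW (card_image_le _ _)).
  apply: L_large; apply: card_le_trans LW _.
  exact: card_le_trans (card_image_le _ _) (countableP _).
- move=> a j; rewrite mem_cat => /orP[]/mapP[k kF ->] /=.
    by exists (b a k).
  by exists (h a k) => //; exact: Gh.
have FGl z x : (inl z \in FG x) = (z \in F x).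
  rewrite mem_cat mem_map; last by move=> ? ? [].
  by rewrite orbC; case: mapP => // -[].
have FGr l x : (inr l \in FG x) = (l \in G x).
  rewrite mem_cat [X in _ || X]mem_map; last by move=> ? ? [].
  by case: mapP => // -[].
exists a, a'; split=> // [z|l] jF jF'.
  by have := vE (inl z); rewrite !FGl => /(_ jF jF')[].
by have := vE (inr l); rewrite !FGr => /(_ jF jF')[].
Qed.

End Regular.

(** * Realization inside the Cantor cube *)

Lemma cube_openP (K : Type) (O : set (cantor_cube K)) :
  open O <-> forall y, O y -> exists F : seq (K -> bool),
    [set y' | {in F, forall z, y' z = y z}] `<=` O.
Proof.
split=> [oO y Oy|OF]; last first.
  rewrite openE => y /OF[F FO]; apply: (filterS FO).
  elim: F {FO} => [|z F IHF]; first by apply: filterS filterT => y' _ z.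
  have zN : nbhs y [set y' : cantor_cube K | y' z = y z].
    exact: (@proj_continuous _ (fun=> bool) z y _ (discrete_set1 (y z))).
  apply: filterS (filterI zN IHF) => y' [/= y'z y'F] w.
  by rewrite inE => /orP[/eqP ->|/y'F].
pose agree : set_system (cantor_cube K) := [set A | exists F : seq (K -> bool),
  [set y' | {in F, forall z, y' z = y z}] `<=` A].
have agreeF : Filter agree.
  split; first by exists [::].
    move=> A B [F FA] [F' F'B]; exists (F ++ F') => y' y'F; split.
      by apply: FA => z zF; apply: y'F; rewrite mem_cat zF.
    by apply: F'B => z zF; apply: y'F; rewrite mem_cat zF orbT.
  by move=> A B AB [F FA]; exists F; exact: subset_trans AB.
suff /(_ O (open_nbhs_nbhs (conj oO Oy))) : agree --> y by [].
apply/cvg_sup => z A [_ [[W _ <-] Wy] WA]; exists [:: z] => y' y'z.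
by apply: WA; rewrite /= y'z ?mem_head.
Qed.

Lemma forced_bij (K L Z : choiceType) (S T : Type) (r : rel L)
    (chi : Z -> S -> bool) (phi : L -> S -> option L) discr
    (c : S -> T) (d : T -> S) : cancel c d -> cancel d c ->
  forced K r chi phi discr ->
  forced K r (fun z => chi z \o d) (fun l => phi l \o d)
    [set E | discr (c @^-1` E)].
Proof.
move=> cK dK [dn iso pc sm]; split.
- move=> F b G h /(dn F b)[s [sF sG]]; exists (c s).
  by split=> [z zF|l lG] /=; rewrite cK; [exact: sF|exact: sG].
- move=> E t /(iso _ (d t))[z zt zE]; exists z => // t' Et' t't; apply: zE.
    by rewrite /= dK.
  by move=> /(can_inj dK).
- move=> E /pc[F [b [G [h [Gh sub]]]]]; exists F, b, G, h; split=> // t [tF tG].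
  by rewrite -(dK t); exact: sub.
- move=> E; have [|le] := sm (c @^-1` E); first by left.
  right; apply: card_le_trans le _.
  rewrite -(card_le_eql (inj_card_eq (in2W (can_inj cK)))).
  by apply: subset_card_le => _ [s Es <-].
Qed.

Theorem theorem4p8 (K L : Type)
  (omega_lt_L : card_lt [set: nat] [set: L])
  (cf_L : is_cofinality L L)
  (L_le_K : [set: L] #<= [set: K]) :
  exists X : set (cantor_cube K),
    [/\ is_C_space X,
        ~ extraresolvable X L,
        ~ resolvable X L &
        forall M : Type, card_lt [set: M] [set: L] ->
          hereditarily_resolvable X M].
Proof.
elim/Pchoice: K => K in L_le_K *.
elim/Pchoice: L => L in omega_lt_L cf_L L_le_K *.
have [natL nLnat] := omega_lt_L.
have [r [r_wo r_init] [_ r_reg]] := cf_L.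
have K_infinite := card_le_trans natL L_le_K.
have Z_infinite := infinite_pred K_infinite.
have [S [chi [phi [discr [SK forcedS]]]]] := forced_system r K_infinite L_le_K.
pose e (s : S) : cantor_cube K := chi^~ s.
(* A singleton is smaller than K, hence discrete, which separates points. *)
have e_inj : injective e.
  move=> s s' ess'; apply: contrapT => nss'.
  have ds' : discr [set s'].
    have [//|le] := forced_small forcedS [set s'].
    by case: (not_card_le_set1 K_infinite le).
  have [z zs zs'] := forced_isolate forcedS s ds'.
  have := congr1 (@^~ z) ess'; rewrite /e zs zs' //.
  by move=> s's; apply: nss'.
pose X : set (cantor_cube K) := range e.
have Xe s : e s \in X by apply/mem_set; exists s.
pose c s : X := SigSub (Xe s).
have /choice[d dP] : forall t : X, exists s, e s = val t.
  by move=> t; have [s _ <-] := set_valP t; exists s.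
have cK : cancel c d by move=> s; apply: e_inj; rewrite dP.
have dK : cancel d c by move=> t; apply: val_inj; rewrite /= dP.
have := forced_bij cK dK forcedS.
set chi' := (fun z => chi z \o d); set discr' := [set E | _].
move=> forcedX.
have chi'E z t : chi' z t = set_val t z.
  by rewrite -[RHS]/((val t : cantor_cube K) z) -dP.
have XE (U : set X) : open U <->
    forall t, U t -> exists F, cyl chi' F (chi'^~ t) `<=` U.
  split=> [[V oV <-] t Vt|UF].
    have [F FV] := (cube_openP V).1 oV _ Vt; exists F => t' t'F.
    by apply: FV => z zF; have := t'F z zF; rewrite !chi'E.
  exists [set y | exists2 t : X, U t &
    exists2 F, {in F, forall z, y z = val t z} &
      cyl chi' F (chi'^~ t) `<=` U].
    apply/cube_openP => y [t Ut [F yF FU]]; exists F => y' y'F.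
    by exists t => //; exists F => // z zF; rewrite y'F ?yF.
  apply/seteqP; split=> [t [t0 Ut0 [F tF FU]]|t Ut].
    by apply: FU => z zF; rewrite !chi'E tF.
  by have [F FU] := UF t Ut; exists t => //; exists F.
have XK : X #= [set: K].
  exact: card_eq_trans (inj_card_eq (in2W e_inj)) SK.
have TK : [set: X] #= [set: K] by exact: card_eq_trans (card_setT X) XK.
have not_extra : ~ extraresolvable X L.
  apply: (forced_not_extraresolvable forcedX Z_infinite XE) => F b G h Gh.
  apply: (regressive_chain_condition r_wo nLnat r_reg F b _ Gh) => l.
  by have [_] := r_init l.
exists X; split=> //.
- split=> //.
  + move=> O [y Oy] /cube_openP/(_ y Oy)[F FO].
    have [s sF] := cyl_neq0 forcedS F y.
    by exists (e s); split; [exact: FO|exists s].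
  + exact: forced_nodec forcedX Z_infinite XE.
  + exact: forced_nwd forcedX Z_infinite XE TK.
  + exact: forced_Delta forcedX Z_infinite XE TK.
- move=> [DD [DDL DDdense DDdisj]]; apply: not_extra; exists DD.
  split=> // D E DDD DDE DE.
  by rewrite DDdisj // /nowhere_dense closure0 interior0.
- move=> M ML; apply: (forced_hereditarily_resolvable forcedX XE).
  exact: (splitting_level r_wo nLnat r_reg ML).
Qed.
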